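(* Let $f\in C^2([0,\infty))$ satisfy $f(u)>0$ for all $u>0$. Let $h\in C^1(-1,1)\cap C[-1,1]$ satisfy $h(-x)=h(x)$ for $x\in(0,1)$, $h(0)>0$, and $x h'(x)\ge 0$ for $x\in(-1,1)$. For $\lambda>0$ consider positive solutions of $$u''+\lambda f(u)-h(x)=0,\quad -1<x<1,\qquad u(-1)=u(1)=0 .$$ Then $u(0)$, which is the maximum value of any positive solution, uniquely identifies the solution pair $(\lambda,u(x))$. That is, if $u$ is a positive solution for $\lambda>0$ and $v$ is a positive solution for $\lambda_1>0$ (with the same $f$ and $h$), and $u(0)=v(0)$, then $\lambda=\lambda_1$ and $u\equiv v$.
   Context: A positive solution is a function $u\in C^2(-1,1)\cap C^1[-1,1]$ satisfying the equation and the boundary conditions with $u(x)>0$ for all $x\in(-1,1)$. *)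

(* Defs.v *)
From Stdlib Require Import Reals.
From Coquelicot Require Import Coquelicot.
Open Scope R_scope.

Definition open_itv (a b : R) : R -> Prop := fun x => a < x < b.
Definition closed_itv (a b : R) : R -> Prop := fun x => a <= x <= b.
Definition nonneg_itv : R -> Prop := fun x => 0 <= x.

(* [D_in] and [continue_in] only look at points of [D], so at an endpoint
   belonging to an interval [D] the derivatives are one-sided, and values of
   the function outside [D] are irrelevant. *)
Fixpoint class_C (k : nat) (D : R -> Prop) (g : R -> R) : Prop :=
  match k with
  | O => forall x, D x -> continue_in g D x
  | S k' => exists g' : R -> R,
      (forall x, D x -> D_in g g' D x) /\ class_C k' D g'
  end.

Record positive_solution (f h : R -> R) (lambda : R) (u : R -> R) : Prop := {
  sol_C2 : class_C 2 (open_itv (-1) 1) u;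
  sol_C1 : class_C 1 (closed_itv (-1) 1) u;
  sol_eq : forall x, -1 < x < 1 -> Derive_n u 2 x + lambda * f (u x) - h x = 0;
  sol_bdl : u (-1) = 0;
  sol_bdr : u 1 = 0;
  sol_pos : forall x, -1 < x < 1 -> 0 < u x
}.

(* Main.v *)
Require Import Defs.
From Stdlib Require Import Reals Lra Psatz Classical.
From Coquelicot Require Import Coquelicot.
Open Scope R_scope.

(** Write [du] for the derivative of a positive solution [u].

    The value [u 0] is the maximum because [u] decreases away from the origin,
    which is the method of moving planes in one dimension.  Reflecting [u]
    through a point [m > 0] brings each [x > m] closer to the origin, where the
    harvesting term [h] is smaller, so the reflected function is a
    supersolution of the equation of [u].  Hence the difference [gap u m] of the
    two obeys [w'' <= K |w|] on [(m, 1)], with [K] from a Lipschitz constant of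
    [f], and vanishes at [m].  When [m] is close to 1 the interval is short and
    the minimum principle makes the gap nonnegative
    ([narrow_minimum_principle]).  Let [m] move left: at the infimum [s] of
    the good positions the gap is still nonnegative, thus positive on [(s, 1]]
    since otherwise it would vanish together with its derivative and could not
    become positive again ([nonpos_after_critical_zero], [gap_pos]).  So a
    position slightly left of [s] would also be good, by compactness away from
    [s] and by the narrow principle near [s].  Therefore no position in [(0, 1)]
    is bad ([moving_planes]), which says that [u y <= u x] for [-y < x <= y]
    ([profile_le]).  As the hypotheses are invariant under [x -> -x], it follows
    that [0] is a maximum, [du 0 = 0], and [du <= 0] on [(0, 1]].

    For uniqueness, let [u] and [v] solve the problem for [l] and [l1] with
    [u 0 = v 0].  If [l < l1] then [u - v] vanishes to first order at [0] and
    has second derivative [(l1 - l) f (u 0) > 0] there, so [v < u] on some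
    [(0, b)] with a first crossing [u b = v b], where [b <= 1] since both vanish
    at 1.  With [F] a primitive of [f], the quantity
    [(du^2 - dv^2)/2 + l F(u) - l1 F(v) - h (u - v)]
    has derivative [- h' (u - v) <= 0] on [(0, b)].  Comparing its values at the
    endpoints gives [(du b)^2 - (dv b)^2 <= 2 (l - l1) (F (u 0) - F (u b)) < 0]
    ([energy_gap]).  But [u] crosses [v] from above at [b], so
    [du b <= dv b <= 0], and the left-hand side is nonnegative
    ([parameters_not_lt]).  By symmetry [l = l1]; then [u] and [v] have the same
    Cauchy data at [0] and coincide because [f] is Lipschitz ([profile_eq]).

    The argument needs one-sided continuity at the endpoints only; composing
    [f], [h], [u] and [du] with retractions onto their domains turns it into
    continuity on the whole line. *)

(** * Calculus on an interval *)

Ltac cont :=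
  intros;
  match goal with
  | |- continuous (fun _ => ?c) ?z => exact (continuous_const c z)
  | |- continuous (fun x => x) ?z => exact (continuous_id z)
  | |- continuous (fun x => @?a x + @?b x) ?z =>
      apply (continuous_plus (K := R_AbsRing) (V := R_NormedModule) a b z); cont
  | |- continuous (fun x => @?a x - @?b x) ?z =>
      apply (continuous_minus (K := R_AbsRing) (V := R_NormedModule) a b z); cont
  | |- continuous (fun x => - @?a x) ?z =>
      apply (continuous_opp (K := R_AbsRing) (V := R_NormedModule) a z); cont
  | |- continuous (fun x => @?a x * @?b x) ?z =>
      apply (continuous_mult (K := R_AbsRing) a b z); cont
  | _ => auto
  end.

(* [auto_derive] leaves eta-expanded occurrences of [Derive]. *)
Ltac known_derive E :=
  match type of E with
  | is_derive ?g ?x ?l =>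
      replace (Derive (fun y : R => g y) x) with l
        by (symmetry; exact (is_derive_unique g x l E))
  end.

Lemma is_derive_continuous (g : R -> R) (x l : R) :
  is_derive g x l -> continuous g x.
Proof. intro H. exact (ex_derive_continuous g x (ex_intro _ l H)). Qed.

Lemma continuous_pt (g : R -> R) (x : R) : continuous g x -> continuity_pt g x.
Proof. intro H. now apply continuity_pt_filterlim. Qed.

Lemma continuous_pos_near (g : R -> R) (x : R) :
  continuous g x -> 0 < g x ->
  exists e, 0 < e /\ forall y, Rabs (y - x) < e -> 0 < g y.
Proof.
  intros Hc Hp. apply continuous_pt in Hc.
  destruct (Hc (g x) Hp) as [e [He H]]. exists e. split; [exact He|].
  intros y Hy. destruct (Req_dec x y) as [<-|Hne]; [exact Hp|].
  assert (Hd : Rabs (g y - g x) < g x).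
  { apply H. repeat split; auto. }
  apply Rabs_def2 in Hd. lra.
Qed.

(** Unlike [MVT_gen], the intermediate point is strictly inside, so nothing
    has to be known about [dg] at the endpoints. *)
Lemma mean_value (g dg : R -> R) (a b : R) :
  a < b ->
  (forall x, a <= x <= b -> continuous g x) ->
  (forall x, a < x < b -> is_derive g x (dg x)) ->
  exists c, a < c < b /\ g b - g a = dg c * (b - a).
Proof.
  intros Hab Hc Hd.
  assert (pr : forall c, a < c < b -> derivable_pt g c).
  { intros c Hi. exists (dg c). apply is_derive_Reals. auto. }
  assert (pr2 : forall c, a < c < b -> derivable_pt id c).
  { intros c _. apply derivable_pt_id. }
  destruct (MVT g id a b pr pr2 Hab) as [c [P HP]].
  - intros c Hi. apply continuous_pt. auto.
  - intros c _. apply continuous_pt. apply continuous_id.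
  - exists c. split; [exact P|].
    rewrite (derive_pt_eq_0 _ _ _ (pr2 c P) (derivable_pt_lim_id c)) in HP.
    rewrite (derive_pt_eq_0 g c (dg c) (pr c P)) in HP.
    + unfold id in HP. lra.
    + apply is_derive_Reals. auto.
Qed.

Lemma derive_nonpos_le (g dg : R -> R) (a b : R) :
  a <= b ->
  (forall x, a <= x <= b -> continuous g x) ->
  (forall x, a < x < b -> is_derive g x (dg x)) ->
  (forall x, a < x < b -> dg x <= 0) ->
  g b <= g a.
Proof.
  intros Hab Hc Hd Hn. destruct (Req_dec a b) as [->|Hne]; [lra|].
  destruct (mean_value g dg a b) as [c [Hi E]]; [lra|auto|auto|].
  specialize (Hn c Hi). nra.
Qed.

Lemma derive_pos_lt (g dg : R -> R) (a b : R) :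
  a < b ->
  (forall x, a <= x <= b -> continuous g x) ->
  (forall x, a < x < b -> is_derive g x (dg x)) ->
  (forall x, a < x < b -> 0 < dg x) ->
  g a < g b.
Proof.
  intros Hab Hc Hd Hn.
  destruct (mean_value g dg a b) as [c [Hi E]]; [lra|auto|auto|].
  specialize (Hn c Hi). nra.
Qed.

(** Fermat's rule at a right endpoint: [g] need not be differentiable at [x],
    but [dg] has a limit there. *)
Lemma derive_nonpos_of_left_min (g dg : R -> R) (a x : R) :
  a < x ->
  (forall y, a <= y <= x -> continuous g y) ->
  (forall y, a < y < x -> is_derive g y (dg y)) ->
  continuous dg x ->
  (forall y, a <= y <= x -> g x <= g y) ->
  dg x <= 0.
Proof.
  intros Hax Hc Hd Hdc Hm. destruct (Rle_or_lt (dg x) 0) as [H|H]; [exact H|].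
  destruct (continuous_pos_near dg x Hdc H) as [e [He Hp]].
  set (y := Rmax a (x - e / 2)).
  assert (Hy : a <= y < x /\ x - e / 2 <= y).
  { unfold y. split; [split|].
    - apply Rmax_l.
    - apply Rmax_lub_lt; lra.
    - apply Rmax_r. }
  assert (g y < g x).
  { apply (derive_pos_lt g dg y x); [lra| | |].
    - intros z Hz. apply Hc. lra.
    - intros z Hz. apply Hd. lra.
    - intros z Hz. apply Hp. apply Rabs_def1; lra. }
  specialize (Hm y). lra.
Qed.

Lemma increasing_right_of_convex_critical (g dg ddg : R -> R) (x b : R) :
  x < b ->
  (forall y, x <= y < b -> is_derive g y (dg y)) ->
  (forall y, x <= y < b -> is_derive dg y (ddg y)) ->
  continuous ddg x -> dg x = 0 -> 0 < ddg x ->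
  exists e, 0 < e /\ x + e < b /\ forall y, x < y <= x + e -> g x < g y.
Proof.
  intros Hxb Hd Hdd Hc H0 Hp.
  destruct (continuous_pos_near ddg x Hc Hp) as [e [He Hpe]].
  set (r := Rmin (e / 2) ((b - x) / 2)).
  assert (Hr : 0 < r /\ r <= e / 2 /\ r <= (b - x) / 2).
  { unfold r. repeat split.
    - apply Rmin_glb_lt; lra.
    - apply Rmin_l.
    - apply Rmin_r. }
  exists r. split; [lra|]. split; [lra|]. intros y Hy.
  assert (Hdg : forall z, x < z <= x + r -> 0 < dg z).
  { intros z Hz. rewrite <- H0. apply (derive_pos_lt dg ddg); [lra| | |].
    - intros t Ht. apply (is_derive_continuous _ _ (ddg t)). apply Hdd. lra.
    - intros t Ht. apply Hdd. lra.
    - intros t Ht. apply Hpe. apply Rabs_def1; lra. }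
  apply (derive_pos_lt g dg); [lra| | |].
  - intros t Ht. apply (is_derive_continuous _ _ (dg t)). apply Hd. lra.
  - intros t Ht. apply Hd. lra.
  - intros t Ht. apply Hdg. lra.
Qed.

Lemma interior_min_critical (g dg : R -> R) (a b x : R) :
  a < x < b -> is_derive g x (dg x) ->
  (forall y, a < y < b -> g x <= g y) -> dg x = 0.
Proof.
  intros Hx Hd Hm. apply is_derive_Reals in Hd.
  rewrite <- (derive_pt_eq_0 g x (dg x) (exist _ _ Hd) Hd).
  apply (deriv_minimum g a b); [lra|lra|]. intros; apply Hm; lra.
Qed.

Lemma interior_min_second_derive (g dg ddg : R -> R) (a b x : R) :
  a < x < b ->
  (forall y, a < y < b -> is_derive g y (dg y)) ->
  (forall y, a < y < b -> is_derive dg y (ddg y)) ->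
  continuous ddg x ->
  (forall y, a < y < b -> g x <= g y) -> 0 <= ddg x.
Proof.
  intros Hx Hd Hdd Hc Hm.
  assert (H0 : dg x = 0).
  { apply (interior_min_critical g dg a b x); auto. }
  destruct (Rle_or_lt 0 (ddg x)) as [H|H]; [exact H|].
  destruct (increasing_right_of_convex_critical
    (fun y => - g y) (fun y => - dg y) (fun y => - ddg y) x b) as [e [He [Heb Hi]]].
  - lra.
  - intros y Hy. apply (is_derive_opp g). apply Hd. lra.
  - intros y Hy. apply (is_derive_opp dg). apply Hdd. lra.
  - cont.
  - lra.
  - lra.
  - specialize (Hi (x + e)). specialize (Hm (x + e)). lra.
Qed.

Lemma first_zero (g : R -> R) (a b : R) :
  a <= b -> (forall x, continuous g x) -> 0 < g a -> g b <= 0 ->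
  exists c, a < c <= b /\ g c = 0 /\ forall x, a <= x < c -> 0 < g x.
Proof.
  intros Hab Hc Ha Hb.
  destruct (completeness (fun c => a <= c <= b /\ forall x, a <= x <= c -> 0 < g x))
    as [c [Hub Hlub]].
  - exists b. intros y [Hy _]. lra.
  - exists a. split; [lra|]. intros x Hx. now replace x with a by lra.
  - assert (Hcb : c <= b) by (apply Hlub; intros y [Hy _]; lra).
    assert (Hac : a <= c).
    { apply Hub. split; [lra|]. intros x Hx. now replace x with a by lra. }
    assert (Hbelow : forall x, a <= x < c -> 0 < g x).
    { intros x Hx. destruct (Rle_or_lt (g x) 0) as [Hn|Hn]; [exfalso|exact Hn].
      assert (c <= x); [|lra]. apply Hlub. intros y [Hy Hyp].
      destruct (Rle_or_lt y x) as [Hyx|Hyx]; [exact Hyx|].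
      specialize (Hyp x). lra. }
    assert (Hgc : g c = 0).
    { destruct (Rtotal_order (g c) 0) as [Hneg|[He|Hpos]]; [exfalso|exact He|exfalso].
      - destruct (continuous_pos_near (fun x => - g x) c) as [e [He Hp]];
          [cont|lra|].
        assert (Hlt : a < c).
        { destruct (Req_dec a c) as [E|]; [rewrite E in Ha; lra|lra]. }
        set (y := Rmax a (c - e / 2)).
        assert (Hy : a <= y < c /\ c - e / 2 <= y).
        { unfold y. split; [split|].
          - apply Rmax_l.
          - apply Rmax_lub_lt; lra.
          - apply Rmax_r. }
        specialize (Hp y ltac:(apply Rabs_def1; lra)).
        specialize (Hbelow y). lra.
      - destruct (continuous_pos_near g c) as [e [He Hp]]; [auto|lra|].
        assert (Hlt : c < b).
        { destruct (Req_dec c b) as [E|]; [rewrite E in Hpos; lra|lra]. }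
        set (y := Rmin b (c + e / 2)).
        assert (Hy : c < y <= b /\ y <= c + e / 2).
        { unfold y. split; [split|].
          - apply Rmin_glb_lt; lra.
          - apply Rmin_l.
          - apply Rmin_r. }
        assert (y <= c); [|lra]. apply Hub. split; [lra|].
        intros x Hx. destruct (Rlt_or_le x c); [apply Hbelow; lra|].
        apply Hp. apply Rabs_def1; lra. }
    exists c. repeat split; auto.
    destruct (Req_dec a c) as [E|]; [rewrite E in Ha; lra|lra].
Qed.

(** * Differential inequalities *)

(** The positive function [p x = 1 - K (x - a)^2] satisfies [p'' <= - 2 K p].
    At a negative minimum of [w / p], with value [-t], the function [w + t p]
    has an interior minimum, which forces [w'' >= 2 K t] there, while the
    hypothesis allows only [w'' <= K t p <= K t]. *)
Lemma narrow_minimum_principle (w dw ddw : R -> R) (K a b : R) :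
  0 < K -> K * (b - a) ^ 2 < 1 ->
  (forall x, continuous w x) ->
  (forall x, a < x < b -> is_derive w x (dw x)) ->
  (forall x, a < x < b -> is_derive dw x (ddw x)) ->
  (forall x, a < x < b -> continuous ddw x) ->
  (forall x, a < x < b -> w x < 0 -> ddw x <= K * - w x) ->
  0 <= w a -> 0 <= w b ->
  forall x, a <= x <= b -> 0 <= w x.
Proof.
  intros HK Hn Hc Hd Hdd Hddc Hi Ha Hb y Hy.
  set (p := fun x => 1 - K * (x - a) ^ 2).
  assert (Hp : forall x, a <= x <= b -> 0 < p x <= 1).
  { intros x Hx. unfold p.
    assert (0 <= (x - a) ^ 2 <= (b - a) ^ 2) by nra. nra. }
  assert (Hpd : forall x, is_derive p x (- (2 * K * (x - a)))).
  { intro x. unfold p. auto_derive; [exact I|ring]. }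
  destruct (continuity_ab_min (fun x => w x / p x) a b) as [x0 [Hm Hx0]]; [lra| |].
  { intros c Hci. apply continuity_pt_div.
    - apply continuous_pt. auto.
    - apply continuous_pt. exact (is_derive_continuous _ _ _ (Hpd c)).
    - specialize (Hp c Hci). lra. }
  destruct (Rle_or_lt 0 (w y)) as [H|Hneg]; [exact H|exfalso].
  set (t := - (w x0 / p x0)).
  pose proof (Hp x0 Hx0) as Hp0.
  assert (Ht : 0 < t).
  { unfold t. specialize (Hm y Hy). pose proof (Hp y Hy).
    assert (w y / p y < 0).
    { apply Rmult_neg_pos; [exact Hneg|]. apply Rinv_0_lt_compat. lra. }
    lra. }
  assert (Hw0 : w x0 = - t * p x0) by (unfold t; field; lra).
  assert (Hin : a < x0 < b).
  { split.
    - destruct (Req_dec a x0) as [E|]; [rewrite <- E in Hw0, Hp0; nra|lra].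
    - destruct (Req_dec x0 b) as [E|]; [rewrite E in Hw0, Hp0; nra|lra]. }
  assert (Hq : 0 <= ddw x0 + t * - (2 * K)).
  { apply (interior_min_second_derive (fun x => w x + t * p x)
      (fun x => dw x + t * - (2 * K * (x - a)))
      (fun x => ddw x + t * - (2 * K)) a b x0 Hin).
    - intros x Hx. apply (is_derive_plus w (fun x => t * p x)); [auto|].
      apply (is_derive_scal p). apply Hpd.
    - intros x Hx. apply (is_derive_plus dw (fun x => t * - (2 * K * (x - a)))); [auto|].
      auto_derive; [exact I|ring].
    - cont.
    - intros x Hx. rewrite Hw0.
      assert (Hxi : a <= x <= b) by lra. specialize (Hm x Hxi). pose proof (Hp x Hxi) as Hpx.
      replace (w x) with (w x / p x * p x) by (field; lra).
      unfold t in *. nra. }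
  assert (Hneg0 : w x0 < 0) by nra.
  specialize (Hi x0 Hin Hneg0). rewrite Hw0 in Hi.
  assert (K * - (- t * p x0) <= K * t); [|nra].
  apply Rmult_le_compat_l; [lra|]. nra.
Qed.

(** With [k^2 = K], the operator [w'' - K w] factors as [(D - k)(D + k) w].
    Multiplying by the integrating factors, first [exp (- k x)] and then
    [exp (k x)], gives two successive monotonicity statements. *)
Lemma nonpos_after_critical_zero (w dw ddw : R -> R) (K a b : R) :
  0 <= K -> a <= b ->
  (forall x, continuous w x) -> (forall x, continuous dw x) ->
  (forall x, a < x < b -> is_derive w x (dw x)) ->
  (forall x, a < x < b -> is_derive dw x (ddw x)) ->
  (forall x, a < x < b -> ddw x <= K * w x) ->
  w a = 0 -> dw a = 0 -> w b <= 0.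
Proof.
  intros HK Hab Hc Hdc Hd Hdd Hi Ha Hda.
  set (k := sqrt K). assert (Hk : k * k = K) by (now apply sqrt_sqrt).
  assert (Hexp : forall c x, continuous (fun x => exp (c * x)) x).
  { intros c x. apply (is_derive_continuous _ _ (c * exp (c * x))).
    auto_derive; [exact I|ring]. }
  assert (Hp : forall x, a <= x <= b -> dw x + k * w x <= 0).
  { intros x Hx.
    assert (H : (dw x + k * w x) * exp (- k * x) <= (dw a + k * w a) * exp (- k * a)).
    { apply (derive_nonpos_le (fun x => (dw x + k * w x) * exp (- k * x))
        (fun x => (ddw x - K * w x) * exp (- k * x))); [lra| | |].
      - intros y _. cont.
      - intros y Hy.
        assert (E1 := Hd y ltac:(lra)). assert (E2 := Hdd y ltac:(lra)).
        auto_derive.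
        + repeat split; eexists; eassumption.
        + known_derive E1. known_derive E2.
          rewrite <- Hk. ring.
      - intros y Hy. specialize (Hi y ltac:(lra)). pose proof (exp_pos (- k * y)). nra. }
    rewrite Ha, Hda in H. pose proof (exp_pos (- k * x)). nra. }
  assert (H : w b * exp (k * b) <= w a * exp (k * a)).
  { apply (derive_nonpos_le (fun x => w x * exp (k * x))
      (fun x => (dw x + k * w x) * exp (k * x))); [lra| | |].
    - intros y _. cont.
    - intros y Hy. assert (E1 := Hd y Hy). auto_derive.
      + repeat split; eexists; eassumption.
      + known_derive E1. ring.
    - intros y Hy. specialize (Hp y ltac:(lra)). pose proof (exp_pos (k * y)). nra. }
  rewrite Ha in H. pose proof (exp_pos (k * b)). nra.
Qed.

(** Gronwall's argument for [w^2 + (w')^2], which grows at rate at most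
    [1 + K]. *)
Lemma zero_after_critical_zero (w dw ddw : R -> R) (K a b : R) :
  0 <= K ->
  (forall x, continuous w x) -> (forall x, continuous dw x) ->
  (forall x, a < x < b -> is_derive w x (dw x)) ->
  (forall x, a < x < b -> is_derive dw x (ddw x)) ->
  (forall x, a < x < b -> Rabs (ddw x) <= K * Rabs (w x)) ->
  w a = 0 -> dw a = 0 -> forall x, a <= x <= b -> w x = 0.
Proof.
  intros HK Hc Hdc Hd Hdd Hi Ha Hda x Hx.
  set (k := 1 + K).
  assert (Hexp : forall y, continuous (fun x => exp (- k * x)) y).
  { intros y. apply (is_derive_continuous _ _ (- k * exp (- k * y))).
    auto_derive; [exact I|ring]. }
  assert (H : (w x * w x + dw x * dw x) * exp (- k * x)
              <= (w a * w a + dw a * dw a) * exp (- k * a)).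
  { apply (derive_nonpos_le (fun x => (w x * w x + dw x * dw x) * exp (- k * x))
      (fun x => (2 * (w x * dw x + dw x * ddw x) - k * (w x * w x + dw x * dw x))
                * exp (- k * x))); [lra| | |].
    - intros y _. cont.
    - intros y Hy.
      assert (E1 := Hd y ltac:(lra)). assert (E2 := Hdd y ltac:(lra)).
      auto_derive.
      + repeat split; eexists; eassumption.
      + known_derive E1. known_derive E2. ring.
    - intros y Hy. specialize (Hi y ltac:(lra)).
      assert (B : forall p q, p * q <= Rabs p * Rabs q).
      { intros p q. rewrite <- Rabs_mult. apply Rle_abs. }
      assert (S : forall p, p * p = Rabs p * Rabs p).
      { intro p. rewrite <- Rabs_mult. symmetry. apply Rabs_right.
        apply Rle_ge, Rle_0_sqr. }
      pose proof (B (w y) (dw y)) as B1. pose proof (B (dw y) (ddw y)) as B2.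
      rewrite (S (w y)), (S (dw y)).
      pose proof (Rabs_pos (w y)). pose proof (Rabs_pos (dw y)).
      assert (Rabs (dw y) * Rabs (ddw y) <= K * (Rabs (w y) * Rabs (dw y))) by nra.
      assert (2 * (Rabs (w y) * Rabs (dw y))
              <= Rabs (w y) * Rabs (w y) + Rabs (dw y) * Rabs (dw y)).
      { pose proof (Rle_0_sqr (Rabs (w y) - Rabs (dw y))) as D. unfold Rsqr in D. lra. }
      assert (2 * (w y * dw y + dw y * ddw y)
              - k * (Rabs (w y) * Rabs (w y) + Rabs (dw y) * Rabs (dw y)) <= 0).
      { unfold k. set (P := Rabs (w y) * Rabs (dw y)) in *.
        set (Q := Rabs (w y) * Rabs (w y) + Rabs (dw y) * Rabs (dw y)) in *.
        assert (K * (2 * P) <= K * Q) by (apply Rmult_le_compat_l; lra). lra. }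
      pose proof (exp_pos (- k * y)). nra. }
  rewrite Ha, Hda in H. pose proof (exp_pos (- k * x)).
  assert (w x * w x + dw x * dw x <= 0).
  { apply (Rmult_le_reg_r (exp (- k * x))); lra. }
  apply Rsqr_0_uniq. unfold Rsqr. pose proof (Rle_0_sqr (w x)) as Hw.
  pose proof (Rle_0_sqr (dw x)) as Hdw. unfold Rsqr in *. lra.
Qed.

(** * Globally continuous data and solutions *)

Record admissible (f h dh : R -> R) : Prop := {
  f_cont : forall t, continuous f t;
  f_pos : forall t, 0 < t -> 0 < f t;
  f_lipschitz : forall M, exists L, forall s t,
    0 <= s <= M -> 0 <= t <= M -> Rabs (f s - f t) <= L * Rabs (s - t);
  h_cont : forall x, continuous h x;
  h_derive : forall x, -1 < x < 1 -> is_derive h x (dh x);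
  h_monotone : forall x, -1 < x < 1 -> 0 <= x * dh x;
  h_even : forall x, -1 < x < 1 -> h (- x) = h x
}.

(** A positive solution, with its derivative extended continuously beyond
    [[-1, 1]]. *)
Record profile (f h : R -> R) (l : R) (u du : R -> R) : Prop := {
  u_cont : forall x, continuous u x;
  du_cont : forall x, continuous du x;
  u_derive : forall x, -1 < x < 1 -> is_derive u x (du x);
  du_derive : forall x, -1 < x < 1 -> is_derive du x (h x - l * f (u x));
  u_left : u (-1) = 0;
  u_right : u 1 = 0;
  u_pos : forall x, -1 < x < 1 -> 0 < u x
}.

Lemma continuous_reflect (g : R -> R) (c x : R) :
  (forall y, continuous g y) -> continuous (fun y => g (c - y)) x.
Proof.
  intro Hg. apply (continuous_comp (fun y => c - y) g); [cont|apply Hg].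
Qed.

Lemma is_derive_reflect (g : R -> R) (c x l : R) :
  is_derive g (c - x) l -> is_derive (fun y => g (c - y)) x (- l).
Proof.
  intro H.
  assert (E : is_derive (fun y => c - y) x (-1)) by (auto_derive; [exact I|ring]).
  replace (- l) with (scal (-1) l).
  - exact (is_derive_comp g (fun y => c - y) x l (-1) H E).
  - change (-1 * l = - l). ring.
Qed.

Lemma profile_nonneg f h l u du x :
  profile f h l u du -> -1 <= x <= 1 -> 0 <= u x.
Proof.
  intros P Hx.
  destruct (Req_dec x (-1)) as [->|]; [rewrite (u_left _ _ _ _ _ P); lra|].
  destruct (Req_dec x 1) as [->|]; [rewrite (u_right _ _ _ _ _ P); lra|].
  apply Rlt_le, (u_pos _ _ _ _ _ P). lra.
Qed.

Lemma profile_reflect f h dh l u du :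
  admissible f h dh -> profile f h l u du ->
  profile f h l (fun x => u (0 - x)) (fun x => - du (0 - x)).
Proof.
  intros A P. constructor.
  - intro x. apply continuous_reflect, P.
  - intro x. apply (continuous_opp (fun x => du (0 - x))).
    apply continuous_reflect, P.
  - intros x Hx. apply is_derive_reflect. apply P. lra.
  - intros x Hx.
    replace (h x) with (h (0 - x)).
    + rewrite <- (Ropp_involutive (h (0 - x) - l * f (u (0 - x)))).
      apply (is_derive_opp (fun x => du (0 - x))), is_derive_reflect, P. lra.
    + replace (0 - x) with (- x) by ring. now apply (h_even _ _ _ A).
  - replace (0 - -1) with 1 by ring. apply P.
  - replace (0 - 1) with (-1) by ring. apply P.
  - intros x Hx. apply P. lra.
Qed.

Lemma h_le (f h dh : R -> R) (x y : R) :
  admissible f h dh -> x < 1 -> - x <= y <= x -> h y <= h x.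
Proof.
  intros A Hx Hy.
  assert (Inc : forall a b, 0 <= a <= b -> b < 1 -> h a <= h b).
  { intros a b Hab Hb.
    assert (- h b <= - h a); [|lra].
    apply (derive_nonpos_le (fun x => - h x) (fun x => - dh x)); [lra| | |].
    - intros z _. pose proof (h_cont _ _ _ A). cont.
    - intros z Hz. apply (is_derive_opp h), A. lra.
    - intros z Hz. pose proof (h_monotone _ _ _ A z). nra. }
  destruct (Rle_or_lt 0 y) as [H|H].
  - apply Inc; lra.
  - rewrite <- (h_even _ _ _ A y); [|lra]. apply Inc; lra.
Qed.

Lemma reaction_lipschitz f h dh l l1 u du v dv :
  admissible f h dh -> 0 < l -> profile f h l u du -> profile f h l1 v dv ->
  exists K, 0 < K /\ forall x y, -1 <= x <= 1 -> -1 <= y <= 1 ->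
    l * Rabs (f (u x) - f (v y)) <= K * Rabs (u x - v y).
Proof.
  intros A Hl P Q.
  destruct (continuity_ab_maj u (-1) 1) as [xu [Hu _]]; [lra| |].
  { intros. apply continuous_pt, P. }
  destruct (continuity_ab_maj v (-1) 1) as [xv [Hv _]]; [lra| |].
  { intros. apply continuous_pt, Q. }
  destruct (f_lipschitz _ _ _ A (Rmax (u xu) (v xv))) as [L HL].
  exists (l * Rmax L 1). split.
  { apply Rmult_lt_0_compat; [lra|]. apply Rlt_le_trans with 1; [lra|apply Rmax_r]. }
  intros x y Hx Hy. rewrite Rmult_assoc. apply Rmult_le_compat_l; [lra|].
  apply Rle_trans with (L * Rabs (u x - v y)).
  - apply HL.
    + split; [now apply (profile_nonneg _ _ _ _ _ _ P)|].
      apply Rle_trans with (u xu); [auto|apply Rmax_l].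
    + split; [now apply (profile_nonneg _ _ _ _ _ _ Q)|].
      apply Rle_trans with (v xv); [auto|apply Rmax_r].
  - apply Rmult_le_compat_r; [apply Rabs_pos|apply Rmax_l].
Qed.

(** * Moving planes *)

Definition gap (u : R -> R) (m x : R) : R := u (2 * m - x) - u x.

Definition gap' (du : R -> R) (m x : R) : R := - du (2 * m - x) - du x.

Definition gap'' (f h : R -> R) (l : R) (u : R -> R) (m x : R) : R :=
  (h (2 * m - x) - l * f (u (2 * m - x))) - (h x - l * f (u x)).

Lemma gap_cont u m x : (forall y, continuous u y) -> continuous (gap u m) x.
Proof.
  intro Hu. apply (continuous_minus (fun x => u (2 * m - x)) u); [|apply Hu].
  now apply continuous_reflect.
Qed.

Lemma gap'_cont du m x :
  (forall y, continuous du y) -> continuous (gap' du m) x.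
Proof.
  intro Hu. apply (continuous_minus (fun x => - du (2 * m - x)) du); [|apply Hu].
  apply (continuous_opp (fun x => du (2 * m - x))). now apply continuous_reflect.
Qed.

Lemma gap''_cont f h dh l u du m x :
  admissible f h dh -> profile f h l u du -> continuous (gap'' f h l u m) x.
Proof.
  intros A P.
  assert (C : forall y, continuous (fun y => h y - l * f (u y)) y).
  { intro y. pose proof (h_cont _ _ _ A).
    assert (continuous (fun y => f (u y)) y)
      by (apply (continuous_comp u f); [apply P|apply A]).
    cont. }
  apply (continuous_minus (fun x => h (2 * m - x) - l * f (u (2 * m - x)))
    (fun y => h y - l * f (u y))); [|apply C].
  apply (continuous_reflect (fun y => h y - l * f (u y)) (2 * m) x C).
Qed.

Lemma gap_derive f h l u du m x :
  profile f h l u du -> 0 <= m -> m < x < 1 ->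
  is_derive (gap u m) x (gap' du m x).
Proof.
  intros P Hm Hx. apply (is_derive_minus (fun x => u (2 * m - x)) u).
  - apply is_derive_reflect, P. lra.
  - apply P. lra.
Qed.

Lemma gap'_derive f h l u du m x :
  profile f h l u du -> 0 <= m -> m < x < 1 ->
  is_derive (gap' du m) x (gap'' f h l u m x).
Proof.
  intros P Hm Hx. apply (is_derive_minus (fun x => - du (2 * m - x)) du).
  - rewrite <- (Ropp_involutive (h (2 * m - x) - _)).
    apply (is_derive_opp (fun x => du (2 * m - x))), is_derive_reflect, P. lra.
  - apply P. lra.
Qed.

(** The reflected point [2 m - x] has absolute value at most [x], so [h] is
    smaller there and the difference of the two [h] terms can be dropped. *)
Lemma gap''_le f h dh l u du m x K :
  admissible f h dh -> profile f h l u du -> 0 < l ->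
  (forall x y, -1 <= x <= 1 -> -1 <= y <= 1 ->
    l * Rabs (f (u x) - f (u y)) <= K * Rabs (u x - u y)) ->
  0 <= m -> m < x < 1 -> gap'' f h l u m x <= K * Rabs (gap u m x).
Proof.
  intros A P Hl HK Hm Hx. unfold gap'', gap.
  pose proof (h_le f h dh x (2 * m - x) A ltac:(lra) ltac:(lra)) as Hh.
  specialize (HK (2 * m - x) x ltac:(lra) ltac:(lra)).
  pose proof (Rle_abs (- (f (u (2 * m - x)) - f (u x)))) as Hf.
  rewrite Rabs_Ropp in Hf. nra.
Qed.

Lemma gap_nonneg_narrow f h dh l u du m b K :
  admissible f h dh -> profile f h l u du -> 0 < l -> 0 < K ->
  (forall x y, -1 <= x <= 1 -> -1 <= y <= 1 ->
    l * Rabs (f (u x) - f (u y)) <= K * Rabs (u x - u y)) ->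
  0 <= m -> b <= 1 -> K * (b - m) ^ 2 < 1 -> 0 <= gap u m b ->
  forall x, m <= x <= b -> 0 <= gap u m x.
Proof.
  intros A P Hl HK HL Hm Hb Hn Hgb.
  apply (narrow_minimum_principle (gap u m) (gap' du m) (gap'' f h l u m) K m b);
    try assumption.
  - intro x. apply gap_cont, P.
  - intros x Hx. apply (gap_derive f h l); [exact P|lra|lra].
  - intros x Hx. apply gap'_derive; [exact P|lra|lra].
  - intros x Hx. now apply (gap''_cont f h dh l u du).
  - intros x Hx Hneg. rewrite <- Rabs_left; [|exact Hneg].
    apply (gap''_le f h dh l u du); try assumption. lra.
  - unfold gap. replace (2 * m - m) with m by ring. lra.
Qed.

Lemma gap_end_pos f h l u du m :
  profile f h l u du -> 0 < m < 1 -> 0 < gap u m 1.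
Proof.
  intros P Hm. unfold gap. rewrite (u_right _ _ _ _ _ P).
  pose proof (u_pos _ _ _ _ _ P (2 * m - 1)). lra.
Qed.

(** A zero of the gap in the interior would be a minimum, hence critical, and
    the gap would then stay nonpositive up to 1, where it equals
    [u (2 m - 1) > 0]. *)
Lemma gap_pos f h dh l u du m :
  admissible f h dh -> profile f h l u du -> 0 < l ->
  0 < m < 1 -> (forall x, m <= x <= 1 -> 0 <= gap u m x) ->
  forall x, m < x <= 1 -> 0 < gap u m x.
Proof.
  intros A P Hl Hm Hg x Hx.
  destruct (reaction_lipschitz f h dh l l u du u du A Hl P P) as [K [HK HL]].
  pose proof (gap_end_pos _ _ _ _ _ _ P Hm) as H1.
  destruct (Req_dec x 1) as [->|Hx1]; [exact H1|].
  destruct (Req_dec (gap u m x) 0) as [H0|H0].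
  2:{ specialize (Hg x ltac:(lra)). lra. }
  exfalso.
  assert (gap u m 1 <= 0); [|lra].
  apply (nonpos_after_critical_zero (gap u m) (gap' du m) (gap'' f h l u m) K x 1);
    try lra.
  - intro y. apply gap_cont, P.
  - intro y. apply gap'_cont, P.
  - intros y Hy. apply (gap_derive f h l); [exact P|lra|lra].
  - intros y Hy. apply gap'_derive; [exact P|lra|lra].
  - intros y Hy. rewrite <- (Rabs_right (gap u m y)).
    + apply (gap''_le f h dh l u du); try assumption; lra.
    + apply Rle_ge, Hg. lra.
  - apply (interior_min_critical (gap u m) (gap' du m) m 1 x); [lra| |].
    + apply (gap_derive f h l); [exact P|lra|lra].
    + intros y Hy. rewrite H0. apply Hg. lra.
Qed.

(** If there were bad positions, their supremum [s] would be at most [1 - d] by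
    the narrow principle.  Badness is an open condition, so [s] itself is good
    and [gap u s] is positive on [(s, 1]].  A bad [r] slightly below [s] is then
    impossible: on [[s + d/2, 1]] its gap is uniformly close to that of [s],
    and [[r, s + d/2]] is narrow. *)
Lemma moving_planes f h dh l u du m :
  admissible f h dh -> profile f h l u du -> 0 < l ->
  0 < m < 1 -> forall x, m <= x <= 1 -> 0 <= gap u m x.
Proof.
  intros A P Hl Hm x Hx.
  destruct (Rle_or_lt 0 (gap u m x)) as [H|H]; [exact H|exfalso].
  destruct (reaction_lipschitz f h dh l l u du u du A Hl P P) as [K [HK HL]].
  set (bad := fun m => 0 < m < 1 /\ exists x, m <= x <= 1 /\ gap u m x < 0).
  (* an interval of length at most [d] is narrow, as [K / (K + 1)^2 < 1] *)
  set (d := / (K + 1)).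
  assert (Hd : 0 < d) by (apply Rinv_0_lt_compat; lra).
  assert (HKd : forall c, 0 <= c <= d -> K * c ^ 2 < 1).
  { intros c Hc.
    assert (E : d * (K + 1) = 1) by (unfold d; field; lra).
    assert (c ^ 2 <= d ^ 2) by nra.
    assert (d < 1) by nra. nra. }
  destruct (completeness bad) as [s [Hub Hlub]].
  { exists 1. intros y [Hy _]. lra. }
  { exists m. split; [exact Hm|now exists x]. }
  assert (Hs1 : s <= 1 - d).
  { apply Hlub. intros y [Hy [z [Hz Hgz]]].
    destruct (Rle_or_lt y (1 - d)) as [|Hyd]; [assumption|exfalso].
    pose proof (gap_end_pos _ _ _ _ _ _ P Hy).
    assert (0 <= gap u y z); [|lra].
    apply (gap_nonneg_narrow f h dh l u du y 1 K); try assumption; try lra.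
    apply HKd. lra. }
  assert (Hs0 : m <= s).
  { apply Hub. split; [exact Hm|now exists x]. }
  assert (Hgs : forall z, s <= z <= 1 -> 0 <= gap u s z).
  { intros z Hz. destruct (Rle_or_lt 0 (gap u s z)) as [|Hneg]; [assumption|exfalso].
    pose proof (gap_end_pos _ _ _ _ _ s P ltac:(lra)) as H1.
    assert (Hsz : s < z).
    { destruct (Req_dec s z) as [<-|]; [|lra].
      unfold gap in Hneg. replace (2 * s - s) with s in Hneg by ring. lra. }
    destruct (continuous_pos_near (fun r => u z - u (2 * r - z)) s) as [e [He Hp]].
    - apply (continuous_minus (fun _ => u z) (fun r => u (2 * r - z)));
        [apply continuous_const|].
      apply (continuous_comp (fun r => 2 * r - z) u); [cont|apply P].
    - unfold gap in Hneg. lra.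
    - set (r := s + Rmin (e / 2) (z - s)).
      assert (Hr : s < r /\ r <= z /\ r < s + e).
      { unfold r. pose proof (Rmin_l (e / 2) (z - s)).
        pose proof (Rmin_r (e / 2) (z - s)).
        pose proof (Rmin_glb_lt (e / 2) (z - s) 0 ltac:(lra) ltac:(lra)). lra. }
      assert (Hz1 : z <> 1) by (intros ->; lra).
      assert (r <= s); [|lra].
      apply Hub. split; [lra|]. exists z. split; [lra|].
      specialize (Hp r ltac:(apply Rabs_def1; lra)). unfold gap. lra. }
  pose proof (gap_pos f h dh l u du s A P Hl ltac:(lra) Hgs) as Hpos.
  set (e := s + d / 2).
  assert (He : s < e < 1) by (unfold e; lra).
  destruct (continuity_ab_min (gap u s) e 1) as [z0 [Hmin Hz0]]; [lra| |].
  { intros c _. apply continuous_pt, gap_cont, P. }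
  assert (Hg0 : 0 < gap u s z0) by (apply Hpos; lra).
  destruct (Heine u (fun c => -1 <= c <= 1) (compact_P3 (-1) 1)
    ltac:(intros; apply continuous_pt, P) (mkposreal _ Hg0)) as [[eta Heta] Hunif].
  simpl in Hunif.
  assert (Hclose : exists r, bad r /\ s - Rmin (eta / 2) (d / 2) < r).
  { apply NNPP. intro Hno.
    assert (s <= s - Rmin (eta / 2) (d / 2)).
    { apply Hlub. intros y Hy.
      destruct (Rle_or_lt y (s - Rmin (eta / 2) (d / 2))); [assumption|].
      exfalso. apply Hno. now exists y. }
    pose proof (Rmin_glb_lt (eta / 2) (d / 2) 0 ltac:(lra) ltac:(lra)). lra. }
  destruct Hclose as [r [[Hr [z [Hz Hgz]]] Hrs]].
  assert (r <= s) by (apply Hub; split; [exact Hr|now exists z]).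
  pose proof (Rmin_l (eta / 2) (d / 2)). pose proof (Rmin_r (eta / 2) (d / 2)).
  assert (Hright : forall c, e <= c <= 1 -> 0 < gap u r c).
  { intros c Hc. specialize (Hmin c Hc).
    assert (Hu : Rabs (u (2 * r - c) - u (2 * s - c)) < gap u s z0).
    { apply Hunif; [lra|lra|]. apply Rabs_def1; lra. }
    apply Rabs_def2 in Hu. unfold gap in *. lra. }
  destruct (Rle_or_lt e z) as [Hez|Hez].
  - specialize (Hright z ltac:(lra)). lra.
  - assert (0 <= gap u r z); [|lra].
    apply (gap_nonneg_narrow f h dh l u du r e K); try assumption; try lra.
    + apply HKd. unfold e in *. lra.
    + apply Rlt_le, Hright. lra.
Qed.

(** The points [x] and [y] are mirror images in their midpoint. *)
Lemma profile_le f h dh l u du x y :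
  admissible f h dh -> profile f h l u du -> 0 < l ->
  - y < x <= y -> y <= 1 -> u y <= u x.
Proof.
  intros A P Hl Hx Hy. destruct (Req_dec x y) as [->|Hne]; [lra|].
  pose proof (moving_planes f h dh l u du ((x + y) / 2) A P Hl ltac:(lra) y ltac:(lra)) as H.
  unfold gap in H. replace (2 * ((x + y) / 2) - y) with x in H by field. lra.
Qed.

Lemma profile_max f h dh l u du x :
  admissible f h dh -> profile f h l u du -> 0 < l ->
  -1 <= x <= 1 -> u x <= u 0.
Proof.
  intros A P Hl Hx. destruct (Rtotal_order x 0) as [H|[->|H]].
  - pose proof (profile_le f h dh l _ _ 0 (- x) A (profile_reflect _ _ _ _ _ _ A P) Hl) as E.
    simpl in E. replace (0 - - x) with x in E by ring. rewrite Rminus_0_r in E.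
    apply E; lra.
  - lra.
  - apply (profile_le f h dh l u du); try assumption; lra.
Qed.

Lemma profile_critical f h dh l u du :
  admissible f h dh -> profile f h l u du -> 0 < l -> du 0 = 0.
Proof.
  intros A P Hl.
  assert (- du 0 = 0); [|lra].
  apply (interior_min_critical (fun x => - u x) (fun x => - du x) (-1) 1); [lra| |].
  - apply (is_derive_opp u), P. lra.
  - intros y Hy. pose proof (profile_max f h dh l u du y A P Hl). lra.
Qed.

Lemma profile_derive_nonpos f h dh l u du x :
  admissible f h dh -> profile f h l u du -> 0 < l -> 0 < x <= 1 -> du x <= 0.
Proof.
  intros A P Hl Hx.
  apply (derive_nonpos_of_left_min u du 0); [lra| | | |].
  - intros. apply P.
  - intros. apply P. lra.
  - apply P.
  - intros y Hy. destruct (Req_dec y 0) as [->|].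
    + apply (profile_max f h dh l u du); try assumption. lra.
    + apply (profile_le f h dh l u du); try assumption; lra.
Qed.

(** * Uniqueness *)

Lemma primitive (f : R -> R) :
  (forall t, continuous f t) -> exists F, forall t, is_derive F t (f t).
Proof.
  intro Hf. exists (fun t => RInt f 0 t). intro t.
  apply (is_derive_RInt f (fun t => RInt f 0 t) 0 t); [|apply Hf].
  apply filter_forall. intro b.
  apply (RInt_correct f), (ex_RInt_continuous f). intros; apply Hf.
Qed.

(** Multiplying each equation by the derivative of its solution and
    subtracting, the [h] terms combine into [h (du - dv)], which is integrated
    by parts so that only the sign of [h'] and of [u - v] matters.  This avoids
    any change of variables through the inverse functions of [u] and [v]. *)
Lemma energy_gap (f h dh F : R -> R) (l l1 : R) (u du v dv : R -> R) (b : R) :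
  admissible f h dh -> (forall t, is_derive F t (f t)) ->
  profile f h l u du -> profile f h l1 v dv ->
  du 0 = 0 -> dv 0 = 0 -> u 0 = v 0 ->
  0 < b <= 1 -> u b = v b -> (forall x, 0 < x < b -> v x <= u x) ->
  (du b * du b - dv b * dv b) / 2 <= (l - l1) * (F (u 0) - F (u b)).
Proof.
  intros A HF P Q Hdu Hdv H0 Hb Hub Hle.
  assert (CF : forall t, continuous F t).
  { intro t. apply (is_derive_continuous _ _ _ (HF t)). }
  set (G := fun x => (du x * du x - dv x * dv x) * / 2 + l * F (u x) - l1 * F (v x)
                     - h x * (u x - v x)).
  assert (HG : G b <= G 0).
  { apply (derive_nonpos_le G (fun x => - dh x * (u x - v x))); [lra| | |].
    - intros x _. unfold G.
      assert (continuous (fun x => F (u x)) x)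
        by (apply (continuous_comp u F); [apply P|apply CF]).
      assert (continuous (fun x => F (v x)) x)
        by (apply (continuous_comp v F); [apply Q|apply CF]).
      pose proof (u_cont _ _ _ _ _ P). pose proof (u_cont _ _ _ _ _ Q).
      pose proof (du_cont _ _ _ _ _ P). pose proof (du_cont _ _ _ _ _ Q).
      pose proof (h_cont _ _ _ A). cont.
    - intros x Hx. unfold G.
      assert (Hi : -1 < x < 1) by lra.
      pose proof (u_derive _ _ _ _ _ P x Hi) as E1.
      pose proof (u_derive _ _ _ _ _ Q x Hi) as E2.
      pose proof (du_derive _ _ _ _ _ P x Hi) as E3.
      pose proof (du_derive _ _ _ _ _ Q x Hi) as E4.
      pose proof (h_derive _ _ _ A x Hi) as E5.
      pose proof (HF (u x)) as E6. pose proof (HF (v x)) as E7.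
      auto_derive.
      + repeat split; eexists; eassumption.
      + known_derive E1. known_derive E2. known_derive E3. known_derive E4.
        known_derive E5. known_derive E6. known_derive E7. field.
    - intros x Hx. specialize (Hle x Hx).
      pose proof (h_monotone _ _ _ A x ltac:(lra)).
      assert (0 <= dh x) by nra. nra. }
  unfold G in HG. rewrite Hdu, Hdv, <- H0, <- Hub in HG. lra.
Qed.

(** The solution with the larger parameter starts below the other one, and
    [energy_gap] makes it strictly steeper at the first point where they meet
    again, which is incompatible with reaching that point from below. *)
Lemma parameters_not_lt (f h dh : R -> R) (l l1 : R) (u du v dv : R -> R) :
  admissible f h dh -> profile f h l u du -> profile f h l1 v dv ->
  0 < l -> 0 < l1 -> u 0 = v 0 -> ~ l < l1.
Proof.
  intros A P Q Hl Hl1 H0 Hlt.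
  pose proof (profile_critical _ _ _ _ _ _ A P Hl) as Hdu.
  pose proof (profile_critical _ _ _ _ _ _ A Q Hl1) as Hdv.
  destruct (primitive f (f_cont _ _ _ A)) as [F HF].
  set (w := fun x => u x - v x).
  set (dw := fun x => du x - dv x).
  set (ddw := fun x => (h x - l * f (u x)) - (h x - l1 * f (v x))).
  assert (Hw : forall x, -1 < x < 1 -> is_derive w x (dw x)).
  { intros x Hx. apply (is_derive_minus u v); [apply P|apply Q]; lra. }
  assert (Hdw : forall x, -1 < x < 1 -> is_derive dw x (ddw x)).
  { intros x Hx. apply (is_derive_minus du dv); [apply P|apply Q]; lra. }
  assert (Cw : forall x, continuous w x).
  { intro x. apply (continuous_minus u v); [apply P|apply Q]. }
  assert (Cdw : forall x, continuous dw x).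
  { intro x. apply (continuous_minus du dv); [apply P|apply Q]. }
  assert (Hw0 : w 0 = 0) by (unfold w; lra).
  destruct (increasing_right_of_convex_critical w dw ddw 0 1) as [e [He [He1 Hinc]]].
  { lra. }
  { intros y Hy. apply Hw. lra. }
  { intros y Hy. apply Hdw. lra. }
  { unfold ddw. pose proof (h_cont _ _ _ A).
    assert (continuous (fun y => f (u y)) 0)
      by (apply (continuous_comp u f); [apply P|apply A]).
    assert (continuous (fun y => f (v y)) 0)
      by (apply (continuous_comp v f); [apply Q|apply A]).
    cont. }
  { unfold dw. lra. }
  { unfold ddw. rewrite <- H0.
    pose proof (f_pos _ _ _ A (u 0) (u_pos _ _ _ _ _ P 0 ltac:(lra))). nra. }
  rewrite Rplus_0_l in *. rewrite Hw0 in Hinc.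
  destruct (first_zero w e 1) as [b [Hb [Hwb Hpos]]]; [lra|exact Cw| | |].
  { apply Hinc. lra. }
  { unfold w. rewrite (u_right _ _ _ _ _ P), (u_right _ _ _ _ _ Q). lra. }
  assert (Hwpos : forall x, 0 < x < b -> 0 < w x).
  { intros x Hx. destruct (Rle_or_lt x e); [apply Hinc|apply Hpos]; lra. }
  assert (Hub : u b = v b) by (unfold w in Hwb; lra).
  pose proof (energy_gap f h dh F l l1 u du v dv b A HF P Q Hdu Hdv H0
    ltac:(lra) Hub) as HG.
  specialize (HG ltac:(intros x Hx; specialize (Hwpos x Hx); unfold w in Hwpos; lra)).
  assert (Hdwb : dw b <= 0).
  { apply (derive_nonpos_of_left_min w dw (b / 2)); [lra| | | |].
    - intros; apply Cw.
    - intros y Hy. apply Hw. lra.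
    - apply Cdw.
    - intros y Hy. rewrite Hwb. destruct (Req_dec y b) as [->|]; [lra|].
      apply Rlt_le, Hwpos. lra. }
  pose proof (profile_derive_nonpos _ _ _ _ _ _ b A Q Hl1 ltac:(lra)) as Hdvb.
  unfold dw in Hdwb.
  (* [v] is nonincreasing, so [u b = v b <= v (b/2) < u (b/2) <= u 0]. *)
  assert (Hub0 : u b < u 0).
  { pose proof (profile_le _ _ _ _ _ _ (b / 2) b A Q Hl1 ltac:(lra) ltac:(lra)).
    pose proof (profile_max _ _ _ _ _ _ (b / 2) A P Hl ltac:(lra)).
    specialize (Hwpos (b / 2) ltac:(lra)). unfold w in Hwpos. lra. }
  assert (HFpos : F (u b) < F (u 0)).
  { apply (derive_pos_lt F f); [exact Hub0| | |].
    - intros t _. apply (is_derive_continuous _ _ _ (HF t)).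
    - intros t _. apply HF.
    - intros t Ht. apply A.
      pose proof (profile_nonneg _ _ _ _ _ b P ltac:(lra)). lra. }
  nra.
Qed.

Lemma profile_eq_right f h dh l u du v dv x :
  admissible f h dh -> profile f h l u du -> profile f h l v dv ->
  0 < l -> u 0 = v 0 -> 0 <= x <= 1 -> u x = v x.
Proof.
  intros A P Q Hl H0 Hx.
  destruct (reaction_lipschitz f h dh l l u du v dv A Hl P Q) as [K [HK HL]].
  assert (u x - v x = 0); [|lra].
  apply (zero_after_critical_zero (fun x => u x - v x) (fun x => du x - dv x)
    (fun x => (h x - l * f (u x)) - (h x - l * f (v x))) K 0 1); try lra.
  - intro y. apply (continuous_minus u v); [apply P|apply Q].
  - intro y. apply (continuous_minus du dv); [apply P|apply Q].
  - intros y Hy. apply (is_derive_minus u v); [apply P|apply Q]; lra.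
  - intros y Hy. apply (is_derive_minus du dv); [apply P|apply Q]; lra.
  - intros y Hy. specialize (HL y y ltac:(lra) ltac:(lra)).
    replace (h y - l * f (u y) - (h y - l * f (v y)))
      with (- (l * (f (u y) - f (v y)))) by ring.
    rewrite Rabs_Ropp, Rabs_mult, (Rabs_right l) by lra. exact HL.
  - rewrite (profile_critical _ _ _ _ _ _ A P Hl), (profile_critical _ _ _ _ _ _ A Q Hl).
    ring.
Qed.

Lemma profile_eq f h dh l u du v dv x :
  admissible f h dh -> profile f h l u du -> profile f h l v dv ->
  0 < l -> u 0 = v 0 -> -1 <= x <= 1 -> u x = v x.
Proof.
  intros A P Q Hl H0 Hx. destruct (Rle_or_lt 0 x) as [H|H].
  - apply (profile_eq_right f h dh l u du v dv); try assumption. lra.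
  - replace x with (0 - - x) by ring.
    apply (profile_eq_right f h dh l (fun x => u (0 - x)) (fun x => - du (0 - x))
      (fun x => v (0 - x)) (fun x => - dv (0 - x))); try assumption; try lra.
    + now apply (profile_reflect f h dh).
    + now apply (profile_reflect f h dh).
    + now rewrite Rminus_0_r.
Qed.

(** * Extension to the whole line *)

(** Being 1-Lipschitz, [p] turns continuity relative to [D] into continuity on
    the whole line: see [retraction_continuous]. *)
Record retraction (D : R -> Prop) (p : R -> R) : Prop := {
  retr_in : forall x, D (p x);
  retr_id : forall x, D x -> p x = x;
  retr_short : forall x y, Rabs (p x - p y) <= Rabs (x - y)
}.

Definition clamp (x : R) : R := Rmax (-1) (Rmin 1 x).

Lemma retraction_clamp : retraction (closed_itv (-1) 1) clamp.
Proof.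
  constructor; unfold closed_itv, clamp; intros.
  - split; [apply Rmax_l|]. apply Rmax_lub; [lra|apply Rmin_l].
  - rewrite Rmin_right, Rmax_right; lra.
  - unfold Rmax, Rmin, Rabs.
    repeat (destruct (Rle_dec _ _) || destruct (Rcase_abs _)); lra.
Qed.

Lemma retraction_nonneg_itv : retraction nonneg_itv (Rmax 0).
Proof.
  constructor; unfold nonneg_itv; intros.
  - apply Rmax_l.
  - rewrite Rmax_right; lra.
  - unfold Rmax, Rabs.
    repeat (destruct (Rle_dec _ _) || destruct (Rcase_abs _)); lra.
Qed.

Lemma retraction_continuous D p g :
  retraction D p -> (forall x, D x -> continue_in g D x) ->
  forall x, continuous (fun y => g (p y)) x.
Proof.
  intros Hp Hg x. apply continuity_pt_filterlim. intros e He.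
  destruct (Hg (p x) (retr_in _ _ Hp x) e He) as [d [Hd H]].
  exists d. split; [exact Hd|]. intros y [_ Hy].
  destruct (Req_dec (p y) (p x)) as [E|E].
  - simpl. unfold R_dist, Rdist. rewrite E, Rminus_diag, Rabs_R0. exact He.
  - apply H. split; [split; [apply Hp|now apply not_eq_sym]|].
    apply Rle_lt_trans with (2 := Hy). apply Hp.
Qed.

Lemma D_in_continue_in g g' D x : D_in g g' D x -> continue_in g D x.
Proof.
  intro H. apply (cont_deriv g g' D x H).
Qed.

Lemma D_in_is_derive g g' (D : R -> Prop) a b x :
  a < x < b -> (forall y, a < y < b -> D y) -> D_in g g' D x -> is_derive g x (g' x).
Proof.
  intros Hx HD H. apply is_derive_Reals. intros e He.
  destruct (H e He) as [d [Hd Hlim]].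
  assert (Hr : 0 < Rmin d (Rmin (x - a) (b - x))).
  { repeat apply Rmin_glb_lt; lra. }
  exists (mkposreal _ Hr). simpl. intros k Hk Hkr.
  pose proof (Rmin_l d (Rmin (x - a) (b - x))).
  pose proof (Rmin_r d (Rmin (x - a) (b - x))).
  pose proof (Rmin_l (x - a) (b - x)). pose proof (Rmin_r (x - a) (b - x)).
  pose proof (Rabs_def2 _ _ Hkr).
  specialize (Hlim (x + k)). simpl in Hlim. unfold Rdist in Hlim.
  replace (x + k - x) with k in Hlim by ring.
  apply Hlim. split; [split|].
  - apply HD. lra.
  - intro E. apply Hk. lra.
  - lra.
Qed.

Lemma is_derive_itv_ext (g1 g2 : R -> R) (a b x l : R) :
  a < x < b -> (forall y, a < y < b -> g1 y = g2 y) ->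
  is_derive g1 x l -> is_derive g2 x l.
Proof.
  intros Hx E. apply is_derive_ext_loc.
  assert (Hr : 0 < Rmin (x - a) (b - x)) by (apply Rmin_glb_lt; lra).
  exists (mkposreal _ Hr). intros y Hy. apply E.
  apply Rabs_def2 in Hy. simpl in Hy.
  pose proof (Rmin_l (x - a) (b - x)). pose proof (Rmin_r (x - a) (b - x)).
  unfold minus, plus, opp in Hy. simpl in Hy. lra.
Qed.

(** The derivative is bounded on [[0, M]] by compactness, and only its values
    at interior points enter the mean value theorem, so the one-sided derivative
    at 0 does no harm. *)
Lemma class_C1_lipschitz f :
  class_C 1 nonneg_itv f ->
  forall M, exists L, forall s t,
    0 <= s <= M -> 0 <= t <= M -> Rabs (f s - f t) <= L * Rabs (s - t).
Proof.
  intros [f' [Hd Hc]] M. simpl in Hc.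
  pose proof (retraction_continuous _ _ _ retraction_nonneg_itv Hc) as Cf'.
  pose proof (retraction_continuous _ _ _ retraction_nonneg_itv
    (fun x Hx => D_in_continue_in _ _ _ _ (Hd x Hx))) as Cf.
  destruct (Rle_or_lt 0 M) as [HM|HM].
  2:{ exists 0. intros. lra. }
  destruct (continuity_ab_maj (fun x => Rabs (f' (Rmax 0 x))) 0 M HM) as [z [Hz _]].
  { intros c _. apply continuous_pt.
    apply (continuous_comp (fun x => f' (Rmax 0 x)) Rabs); [apply Cf'|].
    apply continuous_Rabs. }
  exists (Rabs (f' (Rmax 0 z))).
  assert (Lt : forall s t, 0 <= s < t -> t <= M ->
    Rabs (f t - f s) <= Rabs (f' (Rmax 0 z)) * Rabs (t - s)).
  { intros s t Hs Ht.
    destruct (mean_value (fun x => f (Rmax 0 x)) f' s t) as [c [Hci E]].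
    - lra.
    - intros; apply Cf.
    - intros x Hx. apply (is_derive_itv_ext f _ 0 (x + 1)); [lra| |].
      + intros y Hy. now rewrite Rmax_right by lra.
      + apply (D_in_is_derive f f' nonneg_itv 0 (x + 1)); [lra| |].
        * intros y Hy. unfold nonneg_itv. lra.
        * apply Hd. unfold nonneg_itv. lra.
    - cbv beta in E. rewrite !Rmax_right in E by lra. rewrite E, Rabs_mult.
      apply Rmult_le_compat_r; [apply Rabs_pos|].
      specialize (Hz c ltac:(lra)). cbv beta in Hz.
      now rewrite (Rmax_right 0 c) in Hz by lra. }
  intros s t Hs Ht. destruct (Rtotal_order s t) as [H|[->|H]].
  - rewrite (Rabs_minus_sym (f s)), (Rabs_minus_sym s). apply Lt; lra.
  - rewrite !Rminus_diag, Rabs_R0. lra.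
  - apply Lt; lra.
Qed.

Lemma clamp_id x : -1 <= x <= 1 -> clamp x = x.
Proof. apply (retr_id _ _ retraction_clamp). Qed.

Lemma admissible_of_class f h :
  class_C 2 nonneg_itv f -> (forall t, 0 < t -> 0 < f t) ->
  class_C 1 (open_itv (-1) 1) h -> class_C 0 (closed_itv (-1) 1) h ->
  (forall x, 0 < x < 1 -> h (- x) = h x) ->
  (forall x, -1 < x < 1 -> 0 <= x * Derive h x) ->
  admissible (fun t => f (Rmax 0 t)) (fun x => h (clamp x)) (Derive h).
Proof.
  intros Hf Hfp Hh1 Hh0 He Hm.
  destruct Hf as [f' [Hd [f'' [Hd' _]]]].
  constructor.
  - apply (retraction_continuous _ _ f retraction_nonneg_itv).
    intros x Hx. apply (D_in_continue_in f f'), Hd, Hx.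
  - intros t Ht. rewrite Rmax_right by lra. auto.
  - intro M. destruct (class_C1_lipschitz f) with (M := M) as [L HL].
    + exists f'. split; [exact Hd|]. intros x Hx.
      apply (D_in_continue_in f' f''), Hd', Hx.
    + exists L. intros s t Hs Ht. rewrite !Rmax_right by lra. auto.
  - apply (retraction_continuous _ _ h retraction_clamp), Hh0.
  - intros x Hx. destruct Hh1 as [h' [Hh' _]].
    assert (D : is_derive h x (h' x)).
    { apply (D_in_is_derive h h' (open_itv (-1) 1) (-1) 1); auto. }
    rewrite (is_derive_unique h x _ D).
    apply (is_derive_itv_ext h _ (-1) 1); [exact Hx| |exact D].
    intros y Hy. now rewrite clamp_id by lra.
  - exact Hm.
  - intros x Hx. rewrite !clamp_id by lra.
    destruct (Rtotal_order x 0) as [H|[->|H]].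
    + rewrite <- (He (- x)) by lra. now rewrite Ropp_involutive.
    + now rewrite Ropp_0.
    + apply He. lra.
Qed.

(** On the open interval the two derivatives of [u] provided by its regularity
    classes agree, so the one continuous up to the endpoints is also the one
    that can be differentiated again. *)
Lemma profile_of_solution f h l u :
  positive_solution f h l u ->
  exists du, profile (fun t => f (Rmax 0 t)) (fun x => h (clamp x)) l
    (fun x => u (clamp x)) du.
Proof.
  intros [[g [Hg [g' [Hg' _]]]] [du [Hdu Cdu]] Heq Hl Hr Hp]. simpl in Cdu.
  assert (D1 : forall x, -1 < x < 1 -> is_derive u x (du x)).
  { intros x Hx. apply (D_in_is_derive u du (closed_itv (-1) 1) (-1) 1); [auto| |].
    - unfold closed_itv. intros. lra.
    - apply Hdu. unfold closed_itv. lra. }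
  assert (D1' : forall x, -1 < x < 1 -> is_derive u x (g x)).
  { intros x Hx. apply (D_in_is_derive u g (open_itv (-1) 1) (-1) 1); auto. }
  assert (D2 : forall x, -1 < x < 1 -> is_derive g x (h x - l * f (u x))).
  { intros x Hx.
    assert (E : is_derive g x (g' x)).
    { apply (D_in_is_derive g g' (open_itv (-1) 1) (-1) 1); auto. }
    replace (h x - l * f (u x)) with (g' x); [exact E|].
    specialize (Heq x Hx).
    assert (Derive_n u 2 x = g' x); [|lra].
    apply (is_derive_unique (Derive u)).
    apply (is_derive_itv_ext g _ (-1) 1); [exact Hx| |exact E].
    intros y Hy. symmetry. apply is_derive_unique. auto. }
  exists (fun x => du (clamp x)). constructor.
  - apply (retraction_continuous _ _ u retraction_clamp).
    intros x Hx. apply (D_in_continue_in u du), Hdu, Hx.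
  - apply (retraction_continuous _ _ du retraction_clamp), Cdu.
  - intros x Hx. apply (is_derive_itv_ext u _ (-1) 1); [exact Hx| |].
    + intros y Hy. now rewrite clamp_id by lra.
    + rewrite clamp_id by lra. auto.
  - intros x Hx. rewrite !clamp_id by lra.
    rewrite Rmax_right by (apply Rlt_le; auto).
    apply (is_derive_itv_ext g _ (-1) 1); [exact Hx| |auto].
    intros y Hy. rewrite clamp_id by lra.
    rewrite <- (is_derive_unique u y _ (D1 y Hy)). symmetry.
    apply is_derive_unique. auto.
  - now rewrite clamp_id by lra.
  - now rewrite clamp_id by lra.
  - intros x Hx. rewrite clamp_id by lra. auto.
Qed.

(** * The theorem *)

Theorem lemma2p2 (f h : R -> R)
  (hf : class_C 2 nonneg_itv f)
  (hf_pos : forall t, 0 < t -> 0 < f t)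
  (hh1 : class_C 1 (open_itv (-1) 1) h)
  (hh0 : class_C 0 (closed_itv (-1) 1) h)
  (hh_even : forall x, 0 < x < 1 -> h (- x) = h x)
  (hh_pos : 0 < h 0)
  (hh_mono : forall x, -1 < x < 1 -> 0 <= x * Derive h x) :
  (forall (lambda : R) (u : R -> R),
     0 < lambda -> positive_solution f h lambda u ->
     forall x, -1 <= x <= 1 -> u x <= u 0) /\
  (forall (lambda lambda1 : R) (u v : R -> R),
     0 < lambda -> 0 < lambda1 ->
     positive_solution f h lambda u ->
     positive_solution f h lambda1 v ->
     u 0 = v 0 ->
     lambda = lambda1 /\ (forall x, -1 <= x <= 1 -> u x = v x)).
Proof.
  pose proof (admissible_of_class f h hf hf_pos hh1 hh0 hh_even hh_mono) as A.
  assert (C0 : clamp 0 = 0) by (apply clamp_id; lra).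
  split.
  - intros l u Hl Hu x Hx. destruct (profile_of_solution f h l u Hu) as [du P].
    pose proof (profile_max _ _ _ _ _ _ x A P Hl Hx) as H. cbv beta in H.
    now rewrite C0, clamp_id in H.
  - intros l l1 u v Hl Hl1 Hu Hv H0.
    destruct (profile_of_solution f h l u Hu) as [du P].
    destruct (profile_of_solution f h l1 v Hv) as [dv Q].
    assert (H0' : u (clamp 0) = v (clamp 0)) by now rewrite C0.
    assert (E : l = l1).
    { pose proof (parameters_not_lt _ _ _ _ _ _ _ _ _ A P Q Hl Hl1 H0').
      pose proof (parameters_not_lt _ _ _ _ _ _ _ _ _ A Q P Hl1 Hl (eq_sym H0')).
      lra. }
    split; [exact E|]. subst l1. intros x Hx.
    pose proof (profile_eq _ _ _ _ _ _ _ _ x A P Q Hl H0' Hx) as H. cbv beta in H.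
    now rewrite clamp_id in H.
Qed.
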